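(* Let $\alpha>0$ and $K_0>0$ be fixed and let $\xi$ be an integer-valued $\alpha$-balanced random variable with $\mathbf{P}(|\xi|\le K_0)=1$. Let $M_{n\times(n+u)}$ be a random $n\times(n+u)$ matrix such that its restriction $M_{n\times n}$ to the first $n$ columns is a random symmetric matrix whose entries $(M_{n\times n})_{ij}$, $1\le i\le j\le n$, are i.i.d. copies of $\xi$, and whose last $u$ columns are independent (of each other and of $M_{n\times n}$) with entries being i.i.d. copies of $\xi$. Then for any $A>0$ there exists $B$ such that, for $u=\lfloor B\sqrt{n\log n}\rfloor$ and all sufficiently large $n$, $$\mathbf{P}\Big(\mathbf{Cok}(M_{n\times(n+u)})\simeq\{id\}\Big)\ge 1-n^{-A}.$$
   Context: For $0<\alpha<1$, an integer-valued random variable $\xi$ is $\alpha$-balanced if for every prime $p$, $\max_{x\in\mathbf{Z}/p\mathbf{Z}}\mathbf{P}(\xi\equiv x \bmod p)\le 1-\alpha$. The cokernel of an integer matrix $M_{n\times m}$ is $\mathbf{Cok}(M_{n\times m})=\mathbf{Z}^n/M_{n\times m}(\mathbf{Z}^m)$; it is trivial ($\simeq\{id\}$) exactly when $M_{n\times m}:\mathbf{Z}^m\to\mathbf{Z}^n$ is surjective. *)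

(* Defs.v *)
From HB Require Import structures.
From mathcomp Require Import all_boot all_order all_algebra.
From mathcomp Require Import all_classical all_reals all_analysis.

Set Implicit Arguments.
Unset Strict Implicit.
Unset Printing Implicit Defensive.

Import Order.TTheory GRing.Theory Num.Theory.

Local Open Scope classical_set_scope.
Local Open Scope ring_scope.

(* Integer-valued random variables: int carries the power-set sigma-algebra. *)
HB.instance Definition _ := isPointed.Build int 0.
HB.instance Definition _ := @isMeasurable.Build default_measure_display
  int discrete_measurable discrete_measurable0
  discrete_measurableC discrete_measurableU.

(* The residue field 'F_p is Z/pZ since p is prime. *)
Definition balanced (d : measure_display) (T : measurableType d)
    (R : realType) (P : probability T R) (alpha : R) (xi : {RV P >-> int}) :
    Prop :=
  forall p : nat, prime p ->
    (\big[maxe/-oo]_(x : 'F_p) P [set t | (xi t)%:~R = x] <=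
       (1 - alpha)%:E)%E.

Definition mutually_independent (d d' : measure_display)
    (T : measurableType d) (T' : measurableType d') (R : realType)
    (P : probability T R) (I : finType) (X : I -> {RV P >-> T'}) : Prop :=
  forall (J : {set I}) (E : I -> set T'), (forall i, measurable (E i)) ->
    P (\bigcap_(i in [set` J]) (X i @^-1` E i)) =
    (\prod_(i in J) P (X i @^-1` E i))%E.

(* The copies X i may live on another probability space than xi. *)
Definition iid_copies (d0 d d' : measure_display) (T0 : measurableType d0)
    (T : measurableType d) (T' : measurableType d') (R : realType)
    (P0 : probability T0 R) (P : probability T R) (xi : {RV P0 >-> T'})
    (I : finType) (X : I -> {RV P >-> T'}) : Prop :=
  mutually_independent X /\
  forall (i : I) (E : set T'), measurable E ->
    distribution P (X i) E = distribution P0 xi E.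

(* Indices of the free entries: (i, j) with i <= j in the symmetric block, and
   all the (i, k) in the last u columns. *)
Definition free_index (n u : nat) : finType :=
  ({p : 'I_n * 'I_n | (p.1 <= p.2)%N} + 'I_n * 'I_u)%type.

Definition free_entry (n u : nat) (A : Type) (X : 'I_n -> 'I_(n + u) -> A)
    (e : free_index n u) : A :=
  match e with
  | inl p => X (val p).1 (lshift u (val p).2)
  | inr q => X q.1 (rshift n q.2)
  end.

Definition symmetric_extended (d0 d : measure_display)
    (T0 : measurableType d0) (T : measurableType d) (R : realType)
    (P0 : probability T0 R) (P : probability T R) (xi : {RV P0 >-> int})
    (n u : nat) (X : 'I_n -> 'I_(n + u) -> {RV P >-> int}) : Prop :=
  (forall (i j : 'I_n) (t : T), X i (lshift u j) t = X j (lshift u i) t) /\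
  iid_copies xi (free_entry X).

Definition random_matrix (d : measure_display) (T : measurableType d)
    (R : realType) (P : probability T R) (n m : nat)
    (X : 'I_n -> 'I_m -> {RV P >-> int}) (t : T) : 'M[int]_(n, m) :=
  \matrix_(i, j) X i j t.

(* Membership in the subgroup M(Z^m) of Z^n, as a classical boolean predicate. *)
Definition mximage (n m : nat) (M : 'M[int]_(n, m)) : {pred 'cV[int]_n} :=
  fun v => `[< exists w : 'cV[int]_m, v = M *m w >].

Fact mximage_zmod_closed (n m : nat) (M : 'M[int]_(n, m)) :
  zmod_closed (mximage M).
Proof.
split; first by apply/asboolP; exists 0; rewrite mulmx0.
move=> _ _ /asboolP[v ->] /asboolP[w ->].
by apply/asboolP; exists (v - w); rewrite mulmxBr.
Qed.

HB.instance Definition _ (n m : nat) (M : 'M[int]_(n, m)) :=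
  GRing.isZmodClosed.Build 'cV[int]_n (mximage M) (mximage_zmod_closed M).

Definition Cok (n m : nat) (M : 'M[int]_(n, m)) : zmodType :=
  @Quotient.quot 'cV[int]_n (mximage M).

Definition trivial_group (G : zmodType) : Prop := forall x : G, x = 0.

(* Main.v *)
Require Import Defs.
From HB Require Import structures.
From mathcomp Require Import all_boot all_order all_algebra.
From mathcomp Require Import perm zify ring lra.
From mathcomp Require Import all_classical all_reals all_analysis.

Set Implicit Arguments.
Unset Strict Implicit.
Unset Printing Implicit Defensive.

Import Order.TTheory GRing.Theory Num.Theory.

Local Open Scope ring_scope.

(** The matrix is surjective over the integers exactly when it has rank [n]
    modulo every prime, by Smith normal form ([mulmx_surj_of_full_rank]). The
    probability that this fails for a given prime is exponentially small in [n]
    at best, too large for a union bound over the primes up to the size of the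
    minors; so the matrix is exposed in three stages. Write [q = 1 - alpha], let
    [K] bound the entries and put [N = (n * K) ^ n], which bounds every minor of
    order [n].

    The basic estimate ([mean_in_subspace]) is that a vector of independent
    entries lies in a given subspace of codimension [c] of [F_p ^ n] with
    probability at most [q ^+ c].

    In the first stage the symmetric block is exposed by bordering its leading
    submatrices. The corank modulo [p] can grow only if the new column lies in
    the span of the previous ones; so growth from [c] to [c + 1] has probability
    at most [q ^+ c], and corank [k] for the whole block has probability at most
    [2 ^+ n * q ^+ 'C(k, 2)] ([mean_corank_square]). For [k] of order
    [sqrt (n * ln n)] this is [n ^- (C * n)] with a large constant [C], small
    enough for a union bound over all primes up to [N]. This is where the number
    of additional columns comes from.

    In the second stage, half of the additional columns are used for the prime 2
    only. Each one lowers a positive corank with probability at least [1 - q], so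
    starting from corank at most [k] a constant multiple of [k + ln n] columns
    reaches rank [n] modulo 2 up to a negligible probability
    ([mean_corank_columns]). Then some minor of order [n] is odd, hence nonzero,
    and only its prime divisors can still be bad. They are at most [N], and there
    are at most [n * K * n] of them ([corank_array_mod_few]).

    In the third stage the other half of the columns deals with each of these few
    primes in the same way, all of them starting from corank at most [k].

    The bound is proved for means over a finite product of copies of the law of
    an entry ([mean_deficient]) and then transferred to an arbitrary probability
    space ([mean_le_probability]). *)

(** * Means over a finite power of a finite probability space *)

Section ProductMean.
Context {R : realFieldType} {S E : finType} (mu : S -> R).

Definition mean (F : {ffun E -> S} -> R) : R :=
  \sum_(f : {ffun E -> S}) (\prod_e mu (f e)) * F f.

Definition splice (J : {pred E}) (f g : {ffun E -> S}) : {ffun E -> S} :=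
  [ffun e => if e \in J then g e else f e].

Lemma spliceK J f g : splice J (splice J f g) (splice J g f) = f.
Proof. by apply/ffunP=> e; rewrite !ffunE; case: (e \in J). Qed.

Lemma eq_mean F G : F =1 G -> mean F = mean G.
Proof. by move=> eqFG; apply: eq_bigr => f _; rewrite eqFG. Qed.

Lemma mean_sum (I : Type) (r : seq I) (P : pred I) (F : I -> _ -> R) :
  mean (fun f => \sum_(i <- r | P i) F i f) = \sum_(i <- r | P i) mean (F i).
Proof. by rewrite exchange_big; apply: eq_bigr => f _; rewrite mulr_sumr. Qed.

Lemma meanD F G : mean (fun f => F f + G f) = mean F + mean G.
Proof. by rewrite -big_split; apply: eq_bigr => f _; rewrite mulrDr. Qed.

Lemma meanZ a F : mean (fun f => a * F f) = a * mean F.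
Proof. by rewrite mulr_sumr; apply: eq_bigr => f _; rewrite mulrCA. Qed.

Hypothesis mu_ge0 : forall s, 0 <= mu s.

Lemma ler_mean F G : (forall f, F f <= G f) -> mean F <= mean G.
Proof.
by move=> leFG; apply: ler_sum => f _; apply: ler_wpM2l => //; apply: prodr_ge0.
Qed.

Hypothesis mu_sum1 : \sum_s mu s = 1.

Lemma mean_cst a : mean (fun=> a) = a.
Proof.
rewrite /mean -mulr_suml -(bigA_distr_bigA (fun=> mu)).
by rewrite big1 ?mul1r// => e _.
Qed.

(** Coordinates are independent, so redrawing some of them does not change a
    mean: exchanging the coordinates in [J] of two independent samples is an
    involution that preserves the product weight. *)
Lemma mean_splice J F :
  mean F = mean (fun f => mean (fun g => F (splice J f g))).
Proof.
pose w (f : {ffun E -> S}) := \prod_e mu (f e).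
pose swap (fg : {ffun E -> S} * {ffun E -> S}) :=
  (splice J fg.1 fg.2, splice J fg.2 fg.1).
have swapK : involutive swap by case=> f g; rewrite /swap /= !spliceK.
have w_swap fg : w (swap fg).1 * w (swap fg).2 = w fg.1 * w fg.2.
  rewrite -!big_split; apply: eq_bigr => e _ /=; rewrite !ffunE.
  by case: (e \in J); rewrite // mulrC.
transitivity (\sum_fg w fg.1 * w fg.2 * F fg.1).
  rewrite -(pair_bigA _ (fun f g => w f * w g * F f)); apply: eq_bigr => f _ /=.
  rewrite -[X in _ * X](mean_cst (F f)) mulr_sumr.
  by apply: eq_bigr => g _; rewrite mulrA.
rewrite (reindex_inj (inv_inj swapK)).
rewrite -(pair_bigA _ (fun f g => w (swap (f, g)).1 * w (swap (f, g)).2 *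
                                  F (swap (f, g)).1)).
apply: eq_bigr => f _ /=; rewrite mulr_sumr; apply: eq_bigr => g _.
by rewrite (w_swap (f, g)) mulrA.
Qed.

Lemma mean_forall (J : {pred E}) (Q : E -> pred S) :
  mean (fun f => [forall e in J, Q e (f e)]%:R) =
  \prod_(e in J) \sum_(s | Q e s) mu s.
Proof.
rewrite [RHS]big_mkcond /=.
pose G e s := if (e \in J) ==> Q e s then mu s else 0.
transitivity (\prod_e \sum_s G e s); last first.
  apply: eq_bigr => e _; rewrite /G; case: (e \in J) => /=; last exact: mu_sum1.
  by rewrite -big_mkcond.
rewrite bigA_distr_bigA; apply: eq_bigr => f _.
have [/forallP Qf|/forallPn[e nQe]] := boolP [forall e in J, Q e (f e)].
  by rewrite mulr1; apply: eq_bigr => e _; rewrite /G Qf.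
by rewrite mulr0 (bigD1 e)//= /G (negPf nQe) mul0r.
Qed.

(** A subspace of codimension [k] is cut out by [k] independent linear
    conditions, which are injective on a suitable set of [k] entries. Given the
    other entries, each of these [k] entries must therefore take one specific
    value, which has probability at most [q]. *)
Lemma mean_in_subspace (F : fieldType) (z : S -> F) (q : R) a b
    (V : 'M[F]_(b, a)) (c : 'I_a -> E) :
    injective c -> 0 <= q -> (forall y, \sum_(s | z s == y) mu s <= q) ->
  mean (fun f => (\row_i z (f (c i)) <= V)%MS%:R) <= q ^+ (a - \rank V).
Proof.
move=> c_inj q_ge0 z_le; set x := fun f => \row_i z (f (c i)).
pose C := cokermx V; pose m := maxrankfun C.
pose J := [pred e | e \in codom (c \o m)].
have cardJ : #|J| = (a - \rank V)%N.
  by rewrite -mxrank_coker -[RHS]card_ord; apply/card_codom/inj_comp/maxrankfun_inj.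
have determined f f' : (forall e, e \notin J -> f e = f' e) ->
    (x f <= V)%MS -> (x f' <= V)%MS -> forall e, e \in J -> z (f e) = z (f' e).
  move=> eqff'; rewrite !submxE -/C => /eqP xfC /eqP xf'C _ /codomP[l ->] /=.
  pose y := x f - x f'; have yC : y *m C = 0 by rewrite mulmxBl xfC xf'C subrr.
  suff: rowsub m y^T = 0.
    move/matrixP/(_ l ord0); rewrite !mxE /= => /eqP.
    by rewrite subr_eq0 => /eqP.
  apply: trmx_inj; rewrite trmx0; apply: (row_free_inj (maxrowsub_free C)).
  rewrite mul0mx -yC; apply/rowP => j; rewrite !mxE.
  rewrite (bigID (mem (codom m)))/= [X in _ + X]big1 ?addr0; last first.
    move=> i mNi; rewrite !mxE eqff' ?subrr ?mul0r//.
    apply: contra mNi => /codomP[l' /= /c_inj ->]; exact: codom_f.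
  rewrite (reindex_onto m (fun i => odflt l [pick l' | m l' == i])) /=; last first.
    move=> i /codomP[l' ->]; case: pickP => [l''/eqP//|/(_ l')].
    by rewrite eqxx.
  apply: eq_big => [l'|l' _]; last by rewrite !mxE.
  rewrite codom_f /=; case: pickP => [l'' /eqP/maxrankfun_inj ->|/(_ l')].
    by rewrite eqxx.
  by rewrite eqxx.
rewrite (mean_splice J) -[leRHS]mean_cst; apply: ler_mean => f.
have [[g0 g0V]|noV] :
    (exists g0, x (splice J f g0) <= V)%MS \/
    (forall g, ~~ (x (splice J f g) <= V)%MS).
  have [/existsP|/existsPn] := boolP [exists g0, x (splice J f g0) <= V]%MS.
  - by left.
  - by right.
- apply: (@le_trans _ _
    (mean (fun g => [forall e in J, z (g e) == z (g0 e)]%:R))); last first.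
    rewrite (mean_forall J (fun e s => z s == z (g0 e))) -cardJ -prodr_const.
    by apply: ler_prod => e _; rewrite z_le sumr_ge0.
  apply: ler_mean => g; rewrite ler_nat -/(x _).
  case: (boolP (x _ <= V)%MS) => //= gV; rewrite lt0b.
  apply/forall_inP => e eJ; apply/eqP.
  have := determined _ _ _ gV g0V e eJ; rewrite !ffunE eJ; apply.
  by move=> e' e'J; rewrite !ffunE (negPf e'J).
- rewrite (@eq_mean _ (fun=> 0)) ?mean_cst ?exprn_ge0// => g.
  by rewrite -/(x _) (negPf (noV g)).
Qed.

(** When only the entries of the vector are redrawn, the subspace [V f] and the
    weight [h f] stay fixed, and the bound for a fixed subspace applies. *)
Lemma mean_in_random_subspace (F : fieldType) (z : S -> F) (q : R) a b
    (V : {ffun E -> S} -> 'M[F]_(b, a)) (c : 'I_a -> E)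
    (h : {ffun E -> S} -> R) :
    injective c -> 0 <= q -> (forall y, \sum_(s | z s == y) mu s <= q) ->
    (forall f, 0 <= h f) ->
    (forall f g : {ffun E -> S}, (forall e, e \notin codom c -> f e = g e) ->
      V f = V g /\ h f = h g) ->
  mean (fun f => h f * (\row_i z (f (c i)) <= V f)%MS%:R) <=
  mean (fun f => h f * q ^+ (a - \rank (V f))).
Proof.
move=> c_inj q_ge0 z_le h_ge0 Vh; rewrite (mean_splice (mem (codom c))).
apply: ler_mean => f.
rewrite (@eq_mean _ (fun g => h f * (\row_i z (g (c i)) <= V f)%MS%:R)).
  by rewrite meanZ ler_wpM2l// mean_in_subspace.
move=> g; have [e eNc|-> ->] := Vh (splice (mem (codom c)) f g) f.
  by rewrite ffunE (negPf eNc).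
by congr (_ * (_ <= _)%MS%:R); apply/rowP => i; rewrite !mxE ffunE codom_f.
Qed.

End ProductMean.

(** * Coranks of leading submatrices *)

Section LeadingSubmatrix.
Context {F : fieldType}.
Implicit Types (X : nat -> nat -> F) (a b : nat).

(** The transpose of the leading [a x b] submatrix of an infinite array, so that
    the span of its columns is a row space in the sense of [mxalgebra]. *)
Definition lead X a b : 'M[F]_(b, a) := \matrix_(j, i) X i j.

Definition corank X a b : nat := (a - \rank (lead X a b))%N.

Definition new_column X a b : 'rV[F]_a := \row_i X i b.

Lemma lead_sub X a b b' : (b <= b')%N -> (lead X a b <= lead X a b')%MS.
Proof.
move=> le_bb'; suff -> : lead X a b = rowsub (widen_ord le_bb') (lead X a b').
  exact: rowsub_sub.
by apply/matrixP => j i; rewrite !mxE.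
Qed.

Lemma new_column_sub X a b : (new_column X a b <= lead X a b.+1)%MS.
Proof.
have -> : new_column X a b = row ord_max (lead X a b.+1).
  by apply/rowP => i; rewrite !mxE.
exact: row_sub.
Qed.

Lemma corank_leq X a b b' : (b <= b')%N -> (corank X a b' <= corank X a b)%N.
Proof. by move=> le_bb'; rewrite leq_sub2l// mxrankS// lead_sub. Qed.

Lemma rank_lead_column X a b :
  (\rank (lead X a b) + ~~ (new_column X a b <= lead X a b)%MS <=
   \rank (lead X a b.+1))%N.
Proof.
have [_|newV] := boolP (_ <= _)%MS; first by rewrite addn0 mxrankS// lead_sub.
rewrite addn1; apply: rank_ltmx.
rewrite ltmxE lead_sub//=; apply: contra newV; exact/submx_trans/new_column_sub.
Qed.

Lemma corank_column X a b :
  (corank X a b.+1 <=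
   corank X a b - ~~ (new_column X a b <= lead X a b)%MS)%N.
Proof. by rewrite -subnDA leq_sub2l// rank_lead_column. Qed.

Lemma rank_lead_row X a b : (\rank (lead X a b) <= \rank (lead X a.+1 b))%N.
Proof.
have -> : lead X a b = colsub (widen_ord (leqnSn a)) (lead X a.+1 b).
  by apply/matrixP => j i; rewrite !mxE.
by rewrite -mxrank_tr trmx_mxsub -[leqRHS]mxrank_tr mxrankS// rowsub_sub.
Qed.

(** Bordering a square matrix by a row and a column: a column that leaves the
    span of the previous ones makes up for the additional row. *)
Lemma corank_square X m :
  (corank X m.+1 m.+1 <=
   corank X m m + (new_column X m m <= lead X m m)%MS)%N.
Proof.
have := rank_lead_column X m m; have := rank_lead_row X m m.+1.
have := rank_leq_col (lead X m m).
by rewrite /corank; case: (_ <= _)%MS => /=; lia.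
Qed.

End LeadingSubmatrix.

(** * Coranks of random matrices over a field *)

Section RandomCorank.
Context {R : realFieldType} {S E : finType} (mu : S -> R).
Context (coord : nat -> nat -> E).
Hypothesis mu_ge0 : forall s, 0 <= mu s.
Hypothesis mu_sum1 : \sum_s mu s = 1.

(** This makes the first [a] entries of column [b] independent of each other and
    of the leading [a x b] submatrix. *)
Definition fresh_column a b : Prop :=
  forall i i' j, (i < a)%N -> (i' < a)%N -> (j <= b)%N ->
    coord i b = coord i' j -> i = i' /\ j = b.

Definition determined_by_lead a b (h : {ffun E -> S} -> R) : Prop :=
  forall f g : {ffun E -> S},
    (forall i j, (i < a)%N -> (j < b)%N -> f (coord i j) = g (coord i j)) ->
  h f = h g.

Lemma determined_by_leadW a b b' h :
  (b <= b')%N -> determined_by_lead a b h -> determined_by_lead a b' h.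
Proof.
move=> le_bb' hP f g eqfg; apply: hP => i j lt_ia lt_jb.
exact/eqfg/(leq_trans lt_jb).
Qed.

Context {F : fieldType} (z : S -> F) (q : R).

Definition array (f : {ffun E -> S}) (i j : nat) : F := z (f (coord i j)).

Lemma eq_lead_array a b (f g : {ffun E -> S}) :
    (forall i j, (i < a)%N -> (j < b)%N -> f (coord i j) = g (coord i j)) ->
  lead (array f) a b = lead (array g) a b.
Proof. by move=> eqfg; apply/matrixP => j i; rewrite !mxE /array eqfg. Qed.

Hypothesis q_gt0 : 0 < q.
Hypothesis z_le : forall y, \sum_(s | z s == y) mu s <= q.

Lemma mean_new_column a b h :
    fresh_column a b -> determined_by_lead a b h -> (forall f, 0 <= h f) ->
  mean mu (fun f => h f *
    (new_column (array f) a b <= lead (array f) a b)%MS%:R) <=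
  mean mu (fun f => h f * q ^+ corank (array f) a b).
Proof.
move=> fresh hP h_ge0.
apply: (mean_in_random_subspace mu_ge0 mu_sum1
  (c := fun i : 'I_a => coord i b)) => //.
- move=> i i' /(fresh _ _ _ (ltn_ord i) (ltn_ord i') (leqnn b))[].
  by move/val_inj.
- exact: ltW.
move=> f g eqfg.
have eqfg' i j : (i < a)%N -> (j < b)%N -> f (coord i j) = g (coord i j).
  move=> lt_ia lt_jb; apply: eqfg; apply/codomP => -[i' /esym eq_ij].
  have [_] := fresh _ _ _ (ltn_ord i') lt_ia (ltnW lt_jb) eq_ij.
  by move=> eq_jb; rewrite eq_jb ltnn in lt_jb.
by split; [apply: eq_lead_array | apply: hP].
Qed.

Hypothesis q_le1 : q <= 1.

(** The weight [q^-1 ^+ 'C(c, 2)] of a corank [c] is multiplied by [q^-1 ^+ c]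
    when the corank grows to [c + 1], an event of probability at most
    [q ^+ c]. Each bordering step thus at most doubles the mean weight. *)
Lemma mean_corank_square n : (forall m, (m < n)%N -> fresh_column m m) ->
  mean mu (fun f => q^-1 ^+ 'C(corank (array f) n n, 2)) <= 2 ^+ n.
Proof.
elim: n => [|n IHn] fresh.
  by rewrite expr0 -[leRHS](mean_cst (E := E) mu_sum1); apply: ler_mean.
have r_ge1 : 1 <= q^-1 by rewrite invf_ge1.
pose c f := corank (array f) n n.
pose x_in f := (new_column (array f) n n <= lead (array f) n n)%MS.
apply: (@le_trans _ _ (mean mu (fun f =>
    q^-1 ^+ 'C(c f, 2) + q^-1 ^+ 'C((c f).+1, 2) * (x_in f)%:R))).
  apply: ler_mean => // f; have := corank_square (array f) n.
  rewrite -/(c f) -/(x_in f); case: (x_in f); rewrite ?addn1 ?addn0.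
    rewrite mulr1 => c'_le; apply: ler_wpDl; first exact/exprn_ge0/(le_trans ler01).
    by rewrite ler_weXn2l// leq_bin2l.
  by rewrite mulr0 addr0 => c'_le; rewrite ler_weXn2l// leq_bin2l.
rewrite meanD exprSr mulr_natr mulr2n lerD ?IHn// => [m lt_mn|].
  exact/fresh/ltnW.
apply: le_trans (IHn _) => [|m lt_mn]; last exact/fresh/ltnW.
apply: le_trans (mean_new_column (h := fun f => q^-1 ^+ 'C((c f).+1, 2)) _ _ _) _.
- exact: fresh.
- by move=> f g eqfg; rewrite /c /corank (eq_lead_array eqfg).
- by move=> f; rewrite exprn_ge0// (le_trans ler01).
apply: ler_mean => // f; rewrite -/(c f) binS bin1 exprD -mulrA -exprMn.
by rewrite mulVf ?gt_eqF// expr1n mulr1.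
Qed.

(** The factor [0 < c] makes the weight vanish exactly at full rank; as the
    weight is at least 1 otherwise, its mean bounds the probability of a
    deficiency. *)
Definition corank_weight (c : nat) : R := (0 < c)%N%:R * 2 ^+ c.

Lemma corank_weight_ge0 c : 0 <= corank_weight c.
Proof. by rewrite mulr_ge0 ?exprn_ge0. Qed.

Lemma corank_weight_le c c' : (c <= c')%N -> corank_weight c <= corank_weight c'.
Proof.
move=> le_cc'; rewrite ler_pM ?exprn_ge0// ?ler_weXn2l ?ler1n// ler_nat.
by case: c le_cc' => // c; case: c'.
Qed.

(** While the corank is positive, a new column halves the weight with
    probability at least [1 - q]. *)
Lemma mean_corank_column a b h :
    fresh_column a b -> determined_by_lead a b h -> (forall f, 0 <= h f) ->
  mean mu (fun f => h f * corank_weight (corank (array f) a b.+1)) <=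
  (1 + q) / 2 * mean mu (fun f => h f * corank_weight (corank (array f) a b)).
Proof.
move=> fresh hP h_ge0; pose c f := corank (array f) a b.
pose x_in f := (new_column (array f) a b <= lead (array f) a b)%MS.
pose H f := h f * (corank_weight (c f) / 2).
have H_ge0 f : 0 <= H f by rewrite mulr_ge0// divr_ge0// corank_weight_ge0.
apply: (@le_trans _ _ (mean mu (fun f => H f + H f * (x_in f)%:R))).
  apply: ler_mean => // f; rewrite -{1}[H f]mulr1 -mulrDr -mulrA ler_wpM2l//.
  have := corank_column (array f) a b; rewrite -/(c f) -/(x_in f).
  case: (x_in f) => /= /corank_weight_le; first by rewrite subn0; lra.
  move=> /le_trans; apply; rewrite addr0 mulr1 /corank_weight subn1.
  case: (c f) => [|d] /=; first by rewrite !mul0r.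
  rewrite mul1r exprSr mulfK ?pnatr_eq0//.
  by rewrite ler_piMl ?exprn_ge0// lern1 leq_b1.
rewrite meanD.
have -> : mean mu (fun f => h f * corank_weight (c f)) = mean mu H * 2.
  rewrite mulrC -meanZ; apply: eq_mean => f; rewrite /H; lra.
rewrite mulrCA divfK ?pnatr_eq0// mulrDr mulr1 lerD2l.
apply: le_trans (mean_new_column fresh _ H_ge0) _.
  by move=> f g eqfg; rewrite /H /c /corank (hP f g)// (eq_lead_array eqfg).
rewrite mulrC -meanZ; apply: ler_mean => // f.
rewrite mulrC /H /corank_weight -/(c f); case: (c f) => [|d].
  by rewrite !(mul0r, mulr0).
rewrite ler_wpM2r ?mulr_ge0 ?invr_ge0 ?exprn_ge0//.
by rewrite exprS ler_piMr ?(ltW q_gt0)// exprn_ile1// ltW.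
Qed.

Lemma mean_corank_columns a b j h :
    (forall i, (i < j)%N -> fresh_column a (b + i)) ->
    determined_by_lead a b h -> (forall f, 0 <= h f) ->
  mean mu (fun f => h f * corank_weight (corank (array f) a (b + j))) <=
  ((1 + q) / 2) ^+ j *
    mean mu (fun f => h f * corank_weight (corank (array f) a b)).
Proof.
elim: j => [|j IHj] fresh hP h_ge0; first by rewrite addn0 mul1r.
rewrite addnS exprS -mulrA; apply: le_trans (mean_corank_column _ _ _) _ => //.
- exact: fresh.
- by apply: (determined_by_leadW _ hP); rewrite leq_addr.
rewrite ler_wpM2l ?divr_ge0 ?addr_ge0 ?(ltW q_gt0)//.
by apply: IHj => // i lt_ij; apply: fresh; rewrite ltnW.
Qed.

End RandomCorank.

(** * Integer matrices and their reductions modulo primes *)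

Lemma expn2_size_primes n : (0 < n)%N -> (2 ^ size (primes n) <= n)%N.
Proof.
move=> n_gt0; rewrite [leqRHS](prod_prime_decomp n_gt0) size_map.
have : all (fun f => 1 < f.1 ^ f.2)%N (prime_decomp n).
  apply/allP => -[p e] /mem_prime_decomp[p_pr e_gt0 _] /=.
  by rewrite -(exp1n e) ltn_exp2r// prime_gt1.
elim: (prime_decomp n) => [|f s IHs] /=; first by rewrite big_nil.
by move=> /andP[f_gt1 /IHs IH]; rewrite big_cons expnS leq_mul.
Qed.

Lemma intr_Fp_eq0 p (z : int) : prime p ->
  ((z%:~R : 'F_p) == 0) = (p %| `|z|)%N.
Proof.
move=> p_pr; rewrite {1}[z]intEsign intrM rmorph_sign.
by rewrite mulf_eq0 signr_eq0 -pmulrn -(dvdn_pcharf (pchar_Fp p_pr)).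
Qed.

Lemma leq_fact_expn n : (n`! <= n ^ n)%N.
Proof.
rewrite -ffactnn ffact_prod -[X in (_ <= _ ^ X)%N]card_ord -prod_nat_const.
by apply: leq_prod => i _; rewrite leq_subr.
Qed.

Lemma leq_absz_det n (M : 'M[int]_n) (K : nat) :
  (forall i j, (`|M i j| <= K)%N) -> (`|\det M| <= (n * K) ^ n)%N.
Proof.
move=> M_le; rewrite expnMn -lez_nat abszE.
apply: le_trans (ler_norm_sum _ _ _) _.
apply: (@le_trans _ _ (\sum_(s : 'S_n) (K ^ n)%:Z)); last first.
  rewrite sumr_const card_Sn -mulr_natr natz -PoszM lez_nat.
  by rewrite mulnC leq_mul2r leq_fact_expn orbT.
apply: ler_sum => s _; rewrite normrM normr_sign mul1r normr_prod.
rewrite -[X in (_ ^ X)%N]card_ord -prod_nat_const -natz natr_prod.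
by apply: ler_prod => i _; rewrite normr_ge0 natz -abszE lez_nat M_le.
Qed.

(** Pass to Smith normal form: a diagonal entry that is not a unit has a prime
    divisor, modulo which a row of the diagonal matrix vanishes. *)
Lemma mulmx_surj_of_full_rank n m (M : 'M[int]_(n, m)) :
    (forall p, prime p -> \rank (map_mx (intr : int -> 'F_p) M) = n) ->
  forall v : 'cV_n, exists w : 'cV_m, v = M *m w.
Proof.
move=> rkM v.
have le_nm : (n <= m)%N by rewrite -[leqLHS](rkM 2%N)// rank_leq_col.
have [L Lu [T Tu [d _ defM]]] := int_Smith_normal_form M.
set D := \matrix_(i, j) _ in defM.
have d_unit (i : 'I_n) : d`_i * d`_i = 1.
  set e := d`_i; suff e1 : `|e|%N = 1%N.
    by rewrite -expr2 -real_normK ?num_real// -abszE e1.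
  apply/eqP; apply: contraT => e_neq1.
  have [p p_pr p_e] : exists2 p, prime p & (p %| `|e|)%N.
    have [->|e_gt0] := posnP `|e|%N; first by exists 2%N.
    exists (pdiv `|e|); last exact: pdiv_dvd.
    by apply: pdiv_prime; rewrite ltn_neqAle eq_sym e_neq1.
  pose red k l : 'M[int]_(k, l) -> 'M['F_p]_(k, l) := map_mx intr.
  have rowD : row i (red _ _ D) = 0.
    apply/rowP => j; rewrite !mxE; case: eqP => _; rewrite ?mulr0n ?mulr1n//.
    by apply/eqP; rewrite intr_Fp_eq0.
  have Mp_free : row_free (red _ _ M) by rewrite /row_free rkM.
  have /(row_free_inj Mp_free) : row i (red _ _ (invmx L)) *m red _ _ M = 0 *m red _ _ M.
    rewrite mul0mx -row_mul -map_mxM defM !mulmxA mulVmx// mul1mx map_mxM.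
    by rewrite row_mul rowD mul0mx.
  move/(congr1 (mulmx^~ (red _ _ L))); rewrite mul0mx -row_mul -map_mxM mulVmx//.
  rewrite map_mx1 => /rowP/(_ i)/eqP; rewrite !mxE eqxx.
  by rewrite oner_eq0.
pose y := invmx L *m v.
pose x : 'cV[int]_m :=
  \col_j (if insub (j : nat) is Some i then d`_j * y i 0 else 0).
exists (invmx T *m x); rewrite defM -!mulmxA mulKVmx//.
suff -> : D *m x = y by rewrite mulKVmx.
apply/colP => i; rewrite mxE (bigD1 (widen_ord le_nm i))//= big1 ?addr0.
  by rewrite [D _ _]mxE [x _ _]mxE eqxx mulr1n /= (valK i) mulrA d_unit mul1r.
move=> j; rewrite -(inj_eq val_inj) eq_sym /= => ne_ij.
by rewrite mxE (negPf ne_ij) mulr0n mul0r.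
Qed.

Definition array_mod (X : nat -> nat -> int) (p i j : nat) : 'F_p := (X i j)%:~R.

(** A minor of order [n] that is nonzero modulo one prime is a nonzero integer
    [D], and the rank is full modulo every prime that does not divide [D]. *)
Lemma corank_array_mod_detect X n m K p0 :
    (forall i j, (`|X i j| <= K)%N) ->
    prime p0 -> corank (array_mod X p0) n m = 0%N ->
  exists2 D, (0 < D <= (n * K) ^ n)%N & forall p, prime p -> ~~ (p %| D)%N ->
    corank (array_mod X p) n m = 0%N.
Proof.
move=> X_le p0_pr /eqP; rewrite /corank subn_eq0 => full.
set A := lead _ _ _ in full; have Afull : row_full A by rewrite /row_full eqn_leq rank_leq_col.
pose r := fullrankfun Afull.
pose N : 'M[int]_n := \matrix_(j, i) X i (r j).
have lead_mod p : rowsub r (lead (array_mod X p) n m) = map_mx intr N.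
  by apply/matrixP => j i; rewrite !mxE.
have detN p : \det (rowsub r (lead (array_mod X p) n m)) = (\det N)%:~R.
  by rewrite lead_mod det_map_mx.
exists `|\det N|%N.
  rewrite leq_absz_det ?andbT => [|j i]; last by rewrite mxE.
  rewrite absz_gt0; apply/eqP => N0; have := fullrowsub_unit Afull.
  by rewrite unitmxE detN N0 unitr0.
move=> p p_pr; rewrite -intr_Fp_eq0// -detN => det_neq0.
apply/eqP; rewrite /corank subn_eq0.
apply: leq_trans (mxrankS (rowsub_sub r _)).
by rewrite mxrank_unit// unitmxE unitfE.
Qed.

(** The primes that witness a rank deficiency divide a common nonzero integer
    that is at most [(n * K) ^ n <= 2 ^ (n * K * n)], and each of its distinct
    prime divisors contributes a factor of at least 2. *)
Lemma corank_array_mod_few X n m K p0 N :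
    (forall i j, (`|X i j| <= K)%N) -> (0 < n * K)%N ->
    prime p0 -> corank (array_mod X p0) n m = 0%N ->
  (\sum_(p < N | prime p) (0 < corank (array_mod X p) n m)%N <= n * K * n)%N.
Proof.
move=> X_le nK_gt0 p0_pr full.
have [D /andP[D_gt0 D_le] detD] := corank_array_mod_detect X_le p0_pr full.
apply: (@leq_trans (size (primes D))).
  rewrite -(big_mkord prime (fun p => (0 < corank (array_mod X p) n m)%N : nat)).
  rewrite (eq_bigr (fun p => if (0 < corank (array_mod X p) n m)%N then 1 else 0)%N);
    last by move=> p _; case: ltnP.
  rewrite -big_mkcondr sum1_count -size_filter.
  apply: uniq_leq_size; first by rewrite filter_uniq ?iota_uniq.
  move=> p; rewrite mem_filter => /andP[/andP[p_pr]].
  rewrite mem_primes p_pr D_gt0 lt0n => crk _; apply: contraR crk => pD.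
  by apply/eqP/detD.
rewrite -(@leq_exp2l 2) //; apply: leq_trans (expn2_size_primes D_gt0) _.
apply: leq_trans D_le _; rewrite expnM leq_exp2r; last by case: (n) nK_gt0.
exact/ltnW/ltn_expl.
Qed.

(** * Rank deficiency modulo some prime is unlikely *)

Section Deficiency.
Context {R : realFieldType} {S E : finType} (mu : S -> R).
Context (coord : nat -> nat -> E) (val : S -> int) (K : nat) (q : R).
Hypothesis mu_ge0 : forall s, 0 <= mu s.
Hypothesis mu_sum1 : \sum_s mu s = 1.
Hypothesis q_gt0 : 0 < q.
Hypothesis q_le1 : q <= 1.
Hypothesis mu_balanced : forall p (y : 'F_p), prime p ->
  \sum_(s | (val s)%:~R == y) mu s <= q.
Hypothesis val_le : forall s, (`|val s| <= K)%N.

Definition int_array (f : {ffun E -> S}) (i j : nat) : int := val (f (coord i j)).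

Let crk p f n m : nat := corank (array_mod (int_array f) p) n m.

Let crk_determined p n m m' (f g : {ffun E -> S}) : (m' <= m)%N ->
    (forall i j, (i < n)%N -> (j < m)%N -> f (coord i j) = g (coord i j)) ->
  crk p f n m' = crk p g n m'.
Proof.
move=> le_m'm eqfg; rewrite /crk /corank; congr (_ - \rank _)%N.
apply: (eq_lead_array (fun s => (val s)%:~R)) => i j lt_in lt_jm'.
exact/eqfg/(leq_trans lt_jm').
Qed.

(** Let [N = (n * K) ^ n]. The first summand bounds the probability that the
    square block has corank at least [k] modulo some prime up to [N]. The second
    one bounds the probability that, otherwise,
    - the rank modulo 2 is still deficient after [v] more columns (the 1 in the
      successor), or
    - the rank modulo 2 is full after [v] more columns, but after [v] further
      columns the rank is deficient modulo one of the at most [n * K * n] primes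
      up to [N] for which it was deficient before.
    The primes larger than [N] cannot divide the minor that is nonzero
    modulo 2. *)
Lemma mean_deficient n u v k (good : pred {ffun E -> S}) :
    (1 < n)%N -> (0 < K)%N -> (v + v <= u)%N ->
    (forall m, (m < n)%N -> fresh_column coord m m) ->
    (forall j, (j < u)%N -> fresh_column coord n (n + j)) ->
    (forall f, (forall p, prime p -> crk p f n (n + u) = 0%N) -> good f) ->
  mean mu (fun f => (~~ good f)%:R) <=
    ((n * K) ^ n).+1%:R * (2 ^+ n * q ^+ 'C(k, 2)) +
    (n * K * n).+1%:R * (2 ^+ k * ((1 + q) / 2) ^+ v).
Proof.
move=> n_gt1 K_gt0 le_vu fresh_sq fresh_col goodP.
set N := ((n * K) ^ n)%N; set rho := (1 + q) / 2.
have n_gt0 := ltnW n_gt1.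
have nK_gt1 : (1 < n * K)%N by rewrite (leq_trans n_gt1)// leq_pmulr.
have N_ge2 : (2 < N.+1)%N by rewrite ltnS (leq_trans nK_gt1)// -[leqLHS]expn1 leq_pexp2l// ltnW.
have rho_ge0 : 0 <= rho by rewrite divr_ge0 ?addr_ge0// ltW.
have Xle f i j : (`|int_array f i j| <= K)%N by apply: val_le.
pose small f := [forall p : 'I_N.+1, prime p ==> (crk p f n n < k)%N].
pose h1 f : R := (small f)%:R.
pose h2 f : R := (small f && (crk 2 f n (n + v) == 0%N))%:R.
pose psi p f m : R := corank_weight (crk p f n m).
have psi_ge0 p f m : 0 <= psi p f m by exact: corank_weight_ge0.
have h1_det : determined_by_lead coord n n h1.
  move=> f g eqfg; rewrite /h1 /small; congr (nat_of_bool _)%:R.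
  by apply: eq_forallb => p; rewrite (crk_determined p (leqnn n) eqfg).
have h2_det : determined_by_lead coord n (n + v) h2.
  move=> f g eqfg; rewrite /h2 /small (crk_determined _ (leqnn _) eqfg).
  congr (nat_of_bool (_ && _))%:R.
  by apply: eq_forallb => p; rewrite (crk_determined p (leq_addr _ _) eqfg).
have psi_small p f m : (p < N.+1)%N -> prime p -> (n <= m)%N -> small f ->
    psi p f m <= (0 < crk p f n m)%N%:R * 2 ^+ k.
  move=> lt_pN p_pr le_nm /forallP/(_ (Ordinal lt_pN))/implyP/(_ p_pr)/= c_lt.
  rewrite ler_wpM2l// ler_weXn2l ?ler1n//.
  by rewrite (leq_trans (corank_leq _ _ le_nm))// ltnW.
have psi_ge1 p f m : (0 < crk p f n m)%N -> 1 <= psi p f m.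
  by move=> c_gt0; rewrite /psi /corank_weight c_gt0 mul1r exprn_ege1// ler1n.
(* One of the three bad events occurs, and a term of the matching sum is then at
   least 1. *)
apply: (@le_trans _ _ (mean mu (fun f =>
    \sum_(p < N.+1 | prime p) q ^+ 'C(k, 2) * q^-1 ^+ 'C(crk p f n n, 2) +
    (h1 f * psi 2%N f (n + v)%N +
     \sum_(p < N.+1 | prime p) h2 f * psi p f (n + v + v)%N)))).
  apply: ler_mean => // f.
  have first_ge0 (p : 'I_N.+1) : 0 <= q ^+ 'C(k, 2) * q^-1 ^+ 'C(crk p f n n, 2).
    by rewrite mulr_ge0 ?exprn_ge0 ?invr_ge0// ltW.
  have second_ge0 : 0 <= h1 f * psi 2%N f (n + v)%N by rewrite mulr_ge0.
  have third_ge0 (p : 'I_N.+1) : 0 <= h2 f * psi p f (n + v + v)%N.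
    by rewrite mulr_ge0.
  have first_sum_ge0 : 0 <= \sum_(p < N.+1 | prime p)
    q ^+ 'C(k, 2) * q^-1 ^+ 'C(crk p f n n, 2) by apply: sumr_ge0.
  have third_sum_ge0 : 0 <= \sum_(p < N.+1 | prime p)
    h2 f * psi p f (n + v + v)%N by apply: sumr_ge0.
  have [_|bad] := boolP (good f); first by rewrite !addr_ge0.
  have [sm|/forallPn[p]] := boolP (small f); last first.
    rewrite negb_imply -leqNgt => /andP[p_pr c_ge].
    rewrite ler_wpDr ?addr_ge0// (bigD1 p)//= ler_wpDr ?sumr_ge0// exprVn ler_pdivlMr ?exprn_gt0// mul1r.
    by rewrite ler_wiXn2l ?(ltW q_gt0)// leq_bin2l.
  rewrite ler_wpDl//.
  have [c2|c2] := posnP (crk 2 f n (n + v)); last first.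
    by rewrite ler_wpDr// /h1 sm mul1r psi_ge1.
  rewrite ler_wpDl//.
  have [p p_pr c_gt0] : exists2 p : 'I_N.+1, prime p & (0 < crk p f n (n + v + v))%N.
    apply/exists_inP; apply: contraR bad => /exists_inPn def0.
    apply: goodP => p p_pr; apply/eqP; rewrite -leqn0.
    have [lt_pN|le_Np] := ltnP p N.+1.
      apply: leq_trans (corank_leq _ _ (_ : n + v + v <= _)%N) _.
        by rewrite -addnA leq_add2l.
      by have := def0 (Ordinal lt_pN) p_pr; rewrite -leqNgt.
    apply: leq_trans (corank_leq _ _ (_ : n + v <= _)%N) _.
      by rewrite leq_add2l (leq_trans _ le_vu)// leq_addr.
    have [D /andP[D_gt0 D_le] detD] := corank_array_mod_detect (Xle f) (isT : prime 2) c2.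
    rewrite leqn0; apply/eqP/detD => //.
    by rewrite gtnNdvd// (leq_ltn_trans D_le).
  rewrite (bigD1 p)//= ler_wpDr ?sumr_ge0//.
  by rewrite /h2 sm c2 mul1r psi_ge1.
(* [h] records the outcome of the previous stages. *)
have columns p h m : prime p -> determined_by_lead coord n m h ->
    (forall f, 0 <= h f) -> (n <= m)%N -> (m + v <= n + u)%N ->
  mean mu (fun f => h f * psi p f (m + v)%N) <=
    rho ^+ v * mean mu (fun f => h f * psi p f m).
  move=> p_pr hP h_ge0 le_nm le_mvu.
  apply: (mean_corank_columns mu_ge0 mu_sum1 (z := fun s => (val s)%:~R) q_gt0
    (fun y => mu_balanced y p_pr) q_le1) => // i lt_iv.
  by rewrite -(subnKC le_nm) -addnA; apply: fresh_col; lia.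
rewrite meanD mean_sum lerD//.
  apply: (@le_trans _ _ (\sum_(p < N.+1 | prime p) q ^+ 'C(k, 2) * 2 ^+ n)).
    apply: ler_sum => p p_pr; rewrite meanZ ler_wpM2l ?exprn_ge0 ?(ltW q_gt0)//.
    apply: (mean_corank_square mu_ge0 mu_sum1 (z := fun s => (val s)%:~R) q_gt0
      (fun y => mu_balanced y p_pr) q_le1) => //.
  rewrite [leLHS]big_mkcond -[N.+1 in leRHS]card_ord -sum1_card natr_sum mulr_suml.
  apply: ler_sum => p _; rewrite mul1r mulrC; case: ifP => // _.
  by rewrite mulr_ge0 ?exprn_ge0 ?(ltW q_gt0).
rewrite meanD mean_sum -natr1 addrC mulrDl mul1r lerD//.
  rewrite mulr_natl -mulr_natl [2 ^+ k * _]mulrC mulrCA.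
  apply: (@le_trans _ _ (\sum_(p < N.+1 | prime p)
      rho ^+ v * mean mu (fun f => h2 f * psi p f (n + v)%N))).
    apply: ler_sum => p p_pr; apply: columns => //; first exact: leq_addr.
    by rewrite -addnA leq_add2l.
  rewrite -mulr_sumr ler_wpM2l ?exprn_ge0// -mean_sum -[leRHS](mean_cst (E := E) mu_sum1).
  apply: ler_mean => // f; rewrite -mulr_sumr /h2.
  have [/andP[sm /eqP c2]|_] := boolP (_ && _); last first.
    by rewrite mul0r mulr_ge0 ?exprn_ge0.
  rewrite mul1r.
  apply: (@le_trans _ _ (\sum_(p < N.+1 | prime p)
      (0 < crk p f n (n + v))%N%:R * 2 ^+ k)).
    by apply: ler_sum => p p_pr; apply: psi_small; rewrite ?leq_addr.
  rewrite -mulr_suml ler_wpM2r ?exprn_ge0// -natr_sum ler_nat.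
  exact: (corank_array_mod_few _ (Xle f) (ltnW nK_gt1) (isT : prime 2)).
rewrite [2 ^+ k * _]mulrC.
apply: le_trans (columns 2%N h1 n _ _ _ _ _) _ => //; first by rewrite leq_add2l (leq_trans _ le_vu)// leq_addr.
rewrite ler_wpM2l ?exprn_ge0// -[leRHS](mean_cst (E := E) mu_sum1).
apply: ler_mean => // f; rewrite /h1; case: (boolP (small f)) => [sm|_]; last first.
  by rewrite mul0r exprn_ge0.
rewrite mul1r; apply: le_trans (psi_small _ _ _ N_ge2 _ _ sm) _ => //.
by rewrite ler_piMl ?exprn_ge0// lern1 leq_b1.
Qed.

End Deficiency.

(** * The rate *)

Section Rate.
Context {R : realType}.

Lemma exprn_expR_ln (x : R) n : 0 < x -> x ^+ n = expR (ln x * n%:R).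
Proof. by move=> x_gt0; rewrite expRM_natr lnK// posrE. Qed.

Lemma expR1_ge2 : 2 <= expR 1 :> R.
Proof. exact: le_trans (expR_ge1Dx _). Qed.

Lemma exprn2_le_expR n : 2 ^+ n <= expR n%:R :> R.
Proof. by rewrite -[n%:R]mul1r expRM_natr lerXn2r ?nnegrE ?expR_ge0// expR1_ge2. Qed.

Lemma leq_sqr_bin2 m : (m * m <= 2 * 'C(m.+1, 2))%N.
Proof. by elim: m => // m IHm; rewrite binS bin1; lia. Qed.

(** With [k] of order [C * sqrt (n * ln n)], the factor [q ^+ 'C(k, 2)] is
    [n ^- (c * n)] with [c] of order [C ^+ 2], which beats the number of primes
    to be considered; with [v] of order [B * sqrt (n * ln n)] for [B] large in
    terms of [C], the factor [((1 + q) / 2) ^+ v] beats [2 ^+ k] and any given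
    power of [n]. *)
Lemma deficiency_rate (q A : R) (K : nat) : 0 < q < 1 -> 0 < A ->
  exists B : R, 0 < B /\ exists n0 : nat, forall n, (n0 <= n)%N -> (1 < n)%N /\
    forall u : nat, u%:Z = Num.floor (B * Num.sqrt (n%:R * ln n%:R)) ->
    exists k v, (v + v <= u)%N /\
      ((n * K) ^ n).+1%:R * (2 ^+ n * q ^+ 'C(k, 2)) +
      (n * K * n).+1%:R * (2 ^+ k * ((1 + q) / 2) ^+ v) <= n%:R `^ (- A).
Proof.
move=> /andP[q_gt0 q_lt1] A_gt0.
pose rho := (1 + q) / 2; pose beta := - ln q; pose gamma := - ln rho.
have rho_gt0 : 0 < rho by rewrite /rho; lra.
have beta_gt0 : 0 < beta by rewrite oppr_gt0 ln_lt0// q_gt0.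
have gamma_gt0 : 0 < gamma by rewrite oppr_gt0 ln_lt0// rho_gt0 /rho; lra.
(* [k ~ C * s] gives [q ^+ 'C(k, 2) <= expR (- (A + 6) * (n * ln n))], where
   [4 * (n * ln n)] absorbs [N] and [2 ^+ n]. *)
pose C := Num.sqrt (2 * (A + 6) / beta).
have C_ge0 : 0 <= C := sqrtr_ge0 _.
have C2 : beta * C ^+ 2 = 2 * (A + 6).
  rewrite sqr_sqrtr; first by rewrite mulrC divfK// gt_eqF.
  by rewrite divr_ge0 ?ltW//; lra.
(* [v ~ B * s / 2] with this [B] absorbs [2 ^+ k], the [n ^+ 4] that bounds the
   number of primes, and [n `^ A]. *)
pose B := 2 * (C + A + 7 + gamma) / gamma.
have B_gt0 : 0 < B by rewrite divr_gt0//; lra.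
have Bgamma : gamma * B = 2 * (C + A + 7 + gamma) by rewrite mulrC divfK// gt_eqF.
exists B; split=> //; exists (maxn 2 (maxn K (Num.truncn (expR 1 : R)).+1)) => n.
rewrite !geq_max => /and3P[n_ge2 le_Kn n_gt_e]; split=> // u u_eq.
set x : R := n%:R; set L := ln x; set s := Num.sqrt (x * L).
have x_ge2 : 2 <= x by rewrite ler_nat.
have x_gt0 : 0 < x by lra.
have L_ge1 : 1 <= L.
  rewrite -ler_expR lnK ?posrE//; apply: ltW; apply: lt_le_trans (truncnS_gt _) _.
  by rewrite ler_nat.
have L_le_x : L <= x by apply/ltW/ln_sublinear.
have xL_ge : x <= x * L by rewrite ler_peMr// ltW.
have s2 : s ^+ 2 = x * L by rewrite sqr_sqrtr// mulr_ge0//; lra.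
have s_ge0 : 0 <= s := sqrtr_ge0 _.
have L_le_s : L <= s.
  by rewrite -(ler_pXn2r (n := 2)) ?nnegrE// ?s2 ?expr2 ?ler_wpM2r//; lra.
pose m := (Num.truncn (C * s)).+1.
have Cs_ge0 : 0 <= C * s by rewrite mulr_ge0.
have m_ge : C * s <= m%:R by apply/ltW/truncnS_gt.
have m_le : m%:R <= C * s + 1 by rewrite -natr1 lerD2r truncn_le.
have u_ge : B * s - 1 <= u%:R.
  have := floorD1_gt (B * s); rewrite -u_eq -[u%:Z + 1]/((u%:Z + 1%:Z)%R) => lt_u.
  rewrite lerBlDr ltW//; apply: lt_le_trans lt_u _.
  by rewrite intrD.
have v_ge : B * s - 2 <= 2 * (u./2)%:R.
  have : (u <= (2 * u./2).+1)%N.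
    by rewrite -[leqLHS]odd_double_half mul2n -add1n leq_add2r leq_b1.
  by rewrite -(ler_nat R) -natr1 natrM; lra.
exists m.+1, u./2; split.
  by rewrite addnn -[leqRHS]odd_double_half leq_addl.
have -> : x `^ (- A) = expR (- A * L) by rewrite /powR gt_eqF.
have half : expR (- A * L - 1) <= expR (- A * L) / 2.
  rewrite expRB ler_pM2l ?expR_gt0// lef_pV2 ?posrE ?expR_gt0//; exact: expR1_ge2.
rewrite [leRHS]splitr; apply: lerD; apply: le_trans half.
- have count : ((n * K) ^ n).+1%:R <= expR (1 + L * (2 * n)%:R).
    rewrite expRD -exprn_expR_ln//.
    apply: (@le_trans _ _ (2 * x ^+ (2 * n))); last first.
      by rewrite ler_wpM2r ?exprn_ge0 ?(ltW x_gt0)// expR1_ge2.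
    rewrite -natrX -natrM ler_nat mul2n -addnn -add1n leq_add ?expn_gt0 ?(ltnW n_ge2)//.
    by rewrite expnM leq_exp2r ?(ltnW n_ge2)// expnS expn1 leq_mul2l le_Kn orbT.
  have c_ge : C ^+ 2 * (x * L) <= 2 * 'C(m.+1, 2)%:R.
    apply: (@le_trans _ _ (m%:R * m%:R)).
      by rewrite -s2 -exprMn expr2 ler_pM.
    by rewrite -!natrM ler_nat leq_sqr_bin2.
  rewrite (exprn_expR_ln _ q_gt0).
  apply: le_trans (ler_pM _ _ count (ler_wpM2r _ (exprn2_le_expR n))) _ => //.
  rewrite -!expRD ler_expR natrM -/x -[ln q]opprK -/beta mulNr.
  have : (A + 6) * (x * L) <= beta * 'C(m.+1, 2)%:R.
    have := ler_wpM2l (ltW beta_gt0) c_ge; rewrite (mulrA beta) C2; lra.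
  have : A * L <= A * (x * L) by rewrite ler_wpM2l ?(ltW A_gt0)// ler_peMl//; lra.
  lra.
- have count : (n * K * n).+1%:R <= expR (L * 4%:R).
    rewrite -exprn_expR_ln// -natrX ler_nat.
    apply: (@leq_trans (2 * (n * n * n))).
      rewrite mul2n -addnn -add1n leq_add ?muln_gt0 ?(ltnW n_ge2)//.
      by rewrite leq_mul// leq_mul.
    by rewrite -!mulnA !expnS expn0 muln1 leq_mul.
  rewrite -/rho (exprn_expR_ln _ rho_gt0).
  apply: le_trans (ler_pM _ _ count (ler_wpM2r _ (exprn2_le_expR m.+1))) _ => //.
  rewrite -!expRD ler_expR -[ln rho]opprK -/gamma mulNr -natr1.
  have := ler_wpM2l (ltW gamma_gt0) v_ge; rewrite mulrBr (mulrA gamma) Bgamma.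
  have : A * L <= A * s by rewrite ler_wpM2l ?(ltW A_gt0).
  have : C <= C * s by rewrite ler_peMr//; lra.
  have : gamma <= gamma * s by rewrite ler_peMr// ?(ltW gamma_gt0)//; lra.
  lra.
Qed.

End Rate.

Local Open Scope classical_set_scope.
Local Open Scope ring_scope.

(** * From random variables to finite sums *)

Lemma measure_finite_union (d : measure_display) (T : measurableType d)
    (R : realType) (P : probability T R) (I : finType) (Q : pred I)
    (F : I -> set T) :
    (forall i, measurable (F i)) -> trivIset [set: I] F ->
  P (\bigcup_(i in [set` Q]) F i) = (\sum_(i | Q i) P (F i))%E.
Proof.
move=> mF tF; rewrite measure_fin_bigcup//; last first.
  exact: sub_trivIset tF.
rewrite -[RHS]big_enum /= [RHS]fsbig_seq ?enum_uniq//.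
by apply: eq_fsbigl; apply/seteqP; split=> i /=; rewrite mem_enum.
Qed.

Definition centered (K : nat) (s : 'I_K.*2.+1) : int := (s : nat)%:Z - K%:Z.

Lemma centered_inj K : injective (@centered K).
Proof. by move=> s t /addIr[] /val_inj. Qed.

Lemma leq_abs_centered K s : (`|@centered K s| <= K)%N.
Proof. by rewrite /centered; have := ltn_ord s; lia. Qed.

Lemma centered_surj K (z : int) : (`|z| <= K)%N -> exists s, @centered K s = z.
Proof.
move=> z_le; have lt_zK : (absz (z + K%:Z)%R < K.*2.+1)%N by lia.
by exists (Ordinal lt_zK); rewrite /centered /=; lia.
Qed.

Section Law.
Context {R : realType} {d0 : measure_display} {T0 : measurableType d0}.
Context {P0 : probability T0 R} (xi : {RV P0 >-> int}) (K : nat).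

Definition law (s : 'I_K.*2.+1) : R := fine (P0 (xi @^-1` [set centered s])).

Let m_atom (s : 'I_K.*2.+1) : measurable (xi @^-1` [set centered s]).
Proof. exact: measurable_funPTI. Qed.

Let law_sum (Q : pred 'I_K.*2.+1) : (\sum_(s | Q s) law s)%:E =
  P0 (\bigcup_(s in [set` Q]) xi @^-1` [set centered s]).
Proof.
rewrite measure_finite_union//; last first.
  by move=> s t _ _ [x [/= -> /centered_inj]].
rewrite /law EFin_sum_fine// => s _; exact: fin_num_measure.
Qed.

Lemma law_ge0 s : 0 <= law s.
Proof. by rewrite fine_ge0. Qed.

Lemma law_sum1 : P0 [set t | (`|xi t| <= K)%N] = 1%E -> \sum_s law s = 1.
Proof.
move=> xi_le; apply: EFin_inj; rewrite law_sum -xi_le; congr (P0 _).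
apply/seteqP; split=> [t [s _ /= ->]|t /= /centered_surj[s eq_s]].
  exact: leq_abs_centered.
by exists s.
Qed.

Lemma law_balanced alpha p (y : 'F_p) : balanced alpha xi -> prime p ->
  \sum_(s | (centered s)%:~R == y) law s <= 1 - alpha.
Proof.
move=> xi_bal p_pr; rewrite -lee_fin law_sum.
apply: le_trans (le_trans _ (xi_bal p p_pr)); last exact: (le_bigmax_cond _ (j := y)).
apply: le_measure; rewrite ?inE.
- by apply: fin_bigcup_measurable.
- exact: (measurable_funPTI xi (Y := [set z | z%:~R = y])).
- by move=> t [s /= /eqP <- ->].
Qed.

(** The samples for which [good] holds correspond to disjoint cylinders inside
    the event [G]; by independence, the probability of a cylinder is the product
    weight of its sample. *)
Lemma mean_le_probability (d : measure_display) (T : measurableType d)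
    (P : probability T R) (I : finType) (Y : I -> {RV P >-> int})
    (good : pred {ffun I -> 'I_K.*2.+1}) (G : set T) :
    \sum_s law s = 1 -> iid_copies xi Y -> measurable G ->
    (forall f t, good f -> (forall i, Y i t = centered (f i)) -> G t) ->
  ((1 - mean law (fun f => (~~ good f)%:R))%:E <= P G)%E.
Proof.
move=> sum1 [indep ident] mG goodG.
pose cyl (f : {ffun I -> 'I_K.*2.+1}) : set T :=
  \bigcap_(i in [set` [set: I]%SET]) (Y i @^-1` [set centered (f i)]).
have m_cyl f : measurable (cyl f).
  by apply: fin_bigcap_measurable => // i _; exact: measurable_funPTI.
have P_cyl f : P (cyl f) = (\prod_i law (f i))%:E.
  rewrite (indep [set: I]%SET (fun i => [set centered (f i)]))//.
  rewrite -prodEFin; apply: eq_big => [i|i _]; first by rewrite finset.in_setT.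
  by rewrite fineK ?fin_num_measure//; exact: (ident i [set centered (f i)]).
apply: (@le_trans _ _ (P (\bigcup_(f in [set` good]) cyl f))).
  rewrite measure_finite_union//; last first.
    move=> f g _ _ [t [fY gY]]; apply/ffunP => i; apply: centered_inj.
    by rewrite -(fY i)/= ?finset.in_setT// -(gY i)/= ?finset.in_setT.
  under eq_bigr do rewrite P_cyl.
  rewrite sumEFin lee_fin lerBlDr -[leLHS](mean_cst (E := I) sum1).
  rewrite [\sum_(_ | _) _]big_mkcond -big_split; apply: ler_sum => f _ /=.
  by case: (good f); rewrite /= !(mulr1, mulr0, addr0, add0r).
apply: le_measure; rewrite ?inE//.
  by apply: fin_bigcup_measurable.
move=> t [f /= gf fY]; apply: (goodG f) => // i.
by apply: fY; rewrite /= finset.in_setT.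
Qed.

End Law.

(** There are only countably many integer matrices. *)
Lemma measurable_matrix_event (d : measure_display) (T : measurableType d)
    (R : realType) (P : probability T R) (n m : nat)
    (X : 'I_n -> 'I_m -> {RV P >-> int}) (Q : set 'M[int]_(n, m)) :
  measurable [set t | Q (random_matrix X t)].
Proof.
pose cyl (M : 'M[int]_(n, m)) : set T := [set t | Q M /\ random_matrix X t = M].
have -> : [set t | Q (random_matrix X t)] = \bigcup_M cyl M.
  apply/seteqP; split=> [t Qt|t [M _ []]]; last by move=> QM /= ->.
  by exists (random_matrix X t).
apply: countable_bigcupT_measurable => // M.
have [QM|nQM] := pselect (Q M); last first.
  by rewrite [cyl M](_ : _ = set0)//; apply/seteqP; split=> t // [].
have -> : cyl M = \bigcap_(i in [set: 'I_n]) \bigcap_(j in [set: 'I_m])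
    (X i j @^-1` [set M i j]).
  apply/seteqP; split=> [t [_ <-] i _ j _ /=|t XM]; first by rewrite mxE.
  by split=> //; apply/matrixP => i j; rewrite mxE; apply: XM.
apply: fin_bigcap_measurable => // i _; apply: fin_bigcap_measurable => // j _.
exact: measurable_funPTI.
Qed.

Lemma trivial_Cok (n m : nat) (M : 'M[int]_(n, m)) :
  (forall v : 'cV_n, exists w : 'cV_m, v = M *m w) -> trivial_group (Cok M).
Proof.
move=> surjM x; rewrite -[x]reprK -[0]pi_zeror; apply/eqP.
rewrite -Quotient.idealrBE subr0; apply/asboolP; exact: surjM.
Qed.

(** * The free entries of a symmetric matrix with additional columns *)

Section FreeCoordinates.
Context (n u : nat) (e0 : free_index n u).

Definition ordered_pair (i j : 'I_n) : {p : 'I_n * 'I_n | (p.1 <= p.2)%N} :=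
  insubd (exist _ (i, i) (leqnn i)) (if (i <= j)%N then (i, j) else (j, i)).

Lemma val_ordered_pair i j :
  val (ordered_pair i j) = if (i <= j)%N then (i, j) else (j, i).
Proof. by rewrite val_insubd; case: (leqP i j) => /= [->|/ltnW ->]. Qed.

(** The default value [e0] outside the matrix lets the entries be indexed by
    natural numbers, as the leading submatrices require. *)
Definition free_coord (i j : nat) : free_index n u :=
  match insub i : option 'I_n, insub j : option 'I_(n + u) with
  | Some i', Some j' =>
      match fintype.split j' with
      | inl k => inl (ordered_pair i' k)
      | inr k => inr (i', k)
      end
  | _, _ => e0
  end.

Lemma free_coord_lshift (i j : 'I_n) : free_coord i j = inl (ordered_pair i j).
Proof.
rewrite /free_coord (valK i) (valK (lshift u j) : insub (j : nat) = _).
by rewrite (unsplitK (inl j)).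
Qed.

Lemma free_coord_rshift (i : 'I_n) (k : 'I_u) : free_coord i (n + k) = inr (i, k).
Proof.
rewrite /free_coord (valK i) (valK (rshift n k) : insub (n + k)%N = _).
by rewrite (unsplitK (inr k)).
Qed.

Lemma free_entry_coord (A : Type) (X : 'I_n -> 'I_(n + u) -> A) :
    (forall i j : 'I_n, X i (lshift u j) = X j (lshift u i)) ->
  forall (i : 'I_n) (j : 'I_(n + u)), free_entry X (free_coord i j) = X i j.
Proof.
move=> symX i j; rewrite -[j]splitK; case: (fintype.split j) => k /=.
  rewrite free_coord_lshift /= val_ordered_pair.
  by case: leqP.
by rewrite free_coord_rshift.
Qed.

Lemma fresh_square m : (m < n)%N -> fresh_column free_coord m m.
Proof.
move=> lt_mn i i' j lt_im lt_i'm le_jm.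
have [lt_in lt_i'n] := (ltn_trans lt_im lt_mn, ltn_trans lt_i'm lt_mn).
have lt_jn := leq_ltn_trans le_jm lt_mn.
have := free_coord_lshift (Ordinal lt_in) (Ordinal lt_mn).
have := free_coord_lshift (Ordinal lt_i'n) (Ordinal lt_jn).
rewrite /= => -> -> -[] /(congr1 val); rewrite !val_ordered_pair /= (ltnW lt_im).
by case: leqP => // _ [-> eq_m]; rewrite // -eq_m ltnn in lt_i'm.
Qed.

Lemma fresh_extra k : (k < u)%N -> fresh_column free_coord n (n + k).
Proof.
move=> lt_ku i i' j lt_in lt_i'n le_jnk.
have := free_coord_rshift (Ordinal lt_in) (Ordinal lt_ku); rewrite /= => ->.
have [lt_jn|le_nj] := ltnP j n.
  by have := free_coord_lshift (Ordinal lt_i'n) (Ordinal lt_jn); rewrite /= => ->.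
have lt_ju : (j - n < u)%N by lia.
have := free_coord_rshift (Ordinal lt_i'n) (Ordinal lt_ju).
by rewrite /= subnKC// => -> [-> ->]; rewrite subnKC.
Qed.

End FreeCoordinates.

(** * Surjectivity with high probability *)

Lemma surjective_of_corank n m (M : 'M[int]_(n, m)) (X : nat -> nat -> int) :
    (forall i j, M i j = X i j) ->
    (forall p, prime p -> corank (array_mod X p) n m = 0%N) ->
  trivial_group (Cok M).
Proof.
move=> MX crk0; apply/trivial_Cok/mulmx_surj_of_full_rank => p p_pr.
have -> : map_mx (intr : int -> 'F_p) M = (lead (array_mod X p) n m)^T.
  by apply/matrixP => i j; rewrite !mxE MX.
rewrite mxrank_tr; apply/eqP; rewrite eqn_leq rank_leq_col -subn_eq0.
exact/eqP/crk0.
Qed.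

Lemma probability_trivial_Cok (R : realType) (alpha : R)
    (d0 : measure_display) (T0 : measurableType d0) (P0 : probability T0 R)
    (xi : {RV P0 >-> int}) (K n u v k : nat) (d : measure_display)
    (T : measurableType d) (P : probability T R)
    (X : 'I_n -> 'I_(n + u) -> {RV P >-> int}) :
    0 < alpha < 1 -> balanced alpha xi ->
    P0 [set t | (`|xi t| <= K)%N] = 1%E ->
    symmetric_extended xi X -> (0 < K)%N -> (1 < n)%N -> (v + v <= u)%N ->
  ((1 - (((n * K) ^ n).+1%:R * (2 ^+ n * (1 - alpha) ^+ 'C(k, 2)) +
         (n * K * n).+1%:R * (2 ^+ k * ((1 + (1 - alpha)) / 2) ^+ v)))%:E <=
   P [set t | trivial_group (Cok (random_matrix X t))])%E.
Proof.
move=> /andP[alpha_gt0 alpha_lt1] xi_bal xi_le [symX iidX] K_gt0 n_gt1 le_vu.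
have sum1 := law_sum1 xi_le.
pose i0 := Ordinal (ltnW n_gt1).
pose coord := free_coord (inl (ordered_pair i0 i0) : free_index n u).
pose arr f := int_array coord (@centered K) f.
pose good f := `[< forall p, prime p -> corank (array_mod (arr f) p) n (n + u) = 0%N >].
apply: le_trans (mean_le_probability (good := good) sum1 iidX _ _); last first.
- move=> f t /asboolP gf fX; apply: (surjective_of_corank _ gf) => i j.
  rewrite mxE /arr /int_array -fX.
  rewrite -(free_entry_coord (inl (ordered_pair i0 i0))
    (X := fun i j => X i j t))//.
  by rewrite /coord; case: free_coord.
- exact: (measurable_matrix_event X [set M | trivial_group (Cok M)]).
rewrite lee_fin lerD2l lerN2.
apply: (mean_deficient (coord := coord) (@law_ge0 _ _ _ _ xi K) sum1
  _ _ _ (@leq_abs_centered K) (u := u)) => //.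
- by rewrite subr_gt0.
- by rewrite gerBl ltW.
- by move=> p y p_pr; apply: law_balanced.
- exact: fresh_square.
- exact: fresh_extra.
- by move=> f gf; apply/asboolP.
Qed.

Theorem theorem3p1 (R : realType) (alpha K0 : R)
    (d0 : measure_display) (T0 : measurableType d0) (P0 : probability T0 R)
    (xi : {RV P0 >-> int}) :
  0 < alpha < 1 -> 0 < K0 ->
  balanced alpha xi ->
  P0 [set t | `|xi t|%:~R <= K0] = 1%E ->
  forall A : R, 0 < A ->
  exists B : R, 0 < B /\
  exists n0 : nat, forall n : nat, (n0 <= n)%N ->
    forall u : nat, u%:Z = Num.floor (B * Num.sqrt (n%:R * ln n%:R)) ->
    forall (d : measure_display) (T : measurableType d) (P : probability T R)
      (X : 'I_n -> 'I_(n + u) -> {RV P >-> int}),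
    symmetric_extended xi X ->
    ((1 - n%:R `^ (- A))%:E <=
       P [set t | trivial_group (Cok (random_matrix X t))])%E.
Proof.
move=> alphaP K0_gt0 xi_bal xi_le A A_gt0.
pose K := (Num.truncn K0).+1.
have xi_leK : P0 [set t | (`|xi t| <= K)%N] = 1%E.
  apply/eqP; rewrite eq_le probability_le1 -?xi_le; last first.
    exact: (measurable_funPTI xi (Y := [set z | (`|z| <= K)%N])).
  apply: le_measure; rewrite ?inE.
  - exact: (measurable_funPTI xi (Y := [set z | `|z|%:~R <= K0])).
  - exact: (measurable_funPTI xi (Y := [set z | (`|z| <= K)%N])).
  move=> t /= xi_t; rewrite ltnW// -(ltr_nat R).
  apply: le_lt_trans (truncnS_gt K0).
  by move: xi_t; rewrite -abszE.
have q_itv : 0 < 1 - alpha < 1 by case/andP: alphaP => ? ?; lra.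
have [B [B_gt0 [n0 rate]]] := deficiency_rate K q_itv A_gt0.
exists B; split=> //; exists n0 => n /rate[n_gt1 {}rate] u /rate[k [v [le_vu bound]]].
move=> d T P X symX.
apply: le_trans (probability_trivial_Cok k alphaP xi_bal xi_leK symX _ n_gt1 le_vu) => //.
by rewrite lee_fin lerD2l lerN2.
Qed.
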